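(* For every real $p\geq 2$, each of the four functions $\tilde{P}_p,\ \tilde{T}_p,\ \tilde{L}_p,\ \tilde{M}_p$ of two variables $a>b>0$ defines a mean of $a$ and $b$; that is, for all real $a>b>0$ the value of each of these functions at $(a,b)$ lies between $b=\min(a,b)$ and $a=\max(a,b)$.
   Context: For $p>1$ and $x\in(0,1)$ define $$\arcsin_p(x)=\int_0^x(1-t^p)^{-1/p}\,dt,\quad \arctan_p(x)=\int_0^x(1+t^p)^{-1}\,dt,$$ $$\mathrm{arcsinh}_p(x)=\int_0^x(1+t^p)^{-1/p}\,dt,\quad \mathrm{arctanh}_p(x)=\int_0^x(1-t^p)^{-1}\,dt.$$ For $p\ge 2$ and $a>b>0$ define $$\tilde{P}_p(a,b)=\frac{a-b}{2\arcsin_p\left(\frac{a-b}{a+b}\right)},\quad \tilde{T}_p(a,b)=\frac{a-b}{2\arctan_p\left(\frac{a-b}{a+b}\right)},$$ $$\tilde{L}_p(a,b)=\frac{a-b}{2\,\mathrm{arctanh}_p\left(\frac{a-b}{a+b}\right)},\quad \tilde{M}_p(a,b)=\frac{a-b}{2\,\mathrm{arcsinh}_p\left(\frac{a-b}{a+b}\right)}.$$ A function $\mathcal{M}(a,b)$ of two positive variables is called a mean if $\min(a,b)\le \mathcal{M}(a,b)\le\max(a,b)$. *)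

(* Defs.v *)
From HB Require Import structures.
From mathcomp Require Import all_boot all_order all_algebra.
From mathcomp Require Import all_classical all_reals all_analysis.
Set Implicit Arguments.
Unset Strict Implicit.
Unset Printing Implicit Defensive.
Import Order.TTheory GRing.Theory Num.Theory.
Import numFieldNormedType.Exports.
Local Open Scope classical_set_scope.
Local Open Scope ring_scope.

(* The integrals are real-valued Lebesgue integrals over [0, x].  Since the
   integrands are continuous on [0, x] for p > 1 and 0 < x < 1, they agree with
   the Riemann integrals there; only that range is used. *)

Definition arcsin_p (R : realType) (p x : R) : R :=
  \int[@lebesgue_measure R]_(t in `[0, x]) ((1 - t `^ p) `^ (- p^-1)).

Definition arctan_p (R : realType) (p x : R) : R :=
  \int[@lebesgue_measure R]_(t in `[0, x]) (1 + t `^ p)^-1.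

Definition arcsinh_p (R : realType) (p x : R) : R :=
  \int[@lebesgue_measure R]_(t in `[0, x]) ((1 + t `^ p) `^ (- p^-1)).

Definition arctanh_p (R : realType) (p x : R) : R :=
  \int[@lebesgue_measure R]_(t in `[0, x]) (1 - t `^ p)^-1.

Definition tildeP (R : realType) (p a b : R) : R :=
  (a - b) / (2 * arcsin_p p ((a - b) / (a + b))).

Definition tildeT (R : realType) (p a b : R) : R :=
  (a - b) / (2 * arctan_p p ((a - b) / (a + b))).

Definition tildeL (R : realType) (p a b : R) : R :=
  (a - b) / (2 * arctanh_p p ((a - b) / (a + b))).

Definition tildeM (R : realType) (p a b : R) : R :=
  (a - b) / (2 * arcsinh_p p ((a - b) / (a + b))).

(* D is the domain of definition of M: the functions above are only defined
   for a > b, not for all pairs of positive reals. *)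
Definition is_mean_on (R : realType) (D : R -> R -> Prop) (M : R -> R -> R) :
    Prop :=
  forall a b : R, 0 < a -> 0 < b -> D a b ->
    Num.min a b <= M a b <= Num.max a b.

(* Main.v *)
Require Import Defs.
From HB Require Import structures.
From mathcomp Require Import all_boot all_order all_algebra.
From mathcomp Require Import all_classical all_reals all_analysis.
From mathcomp Require Import lra.
Import Order.TTheory GRing.Theory Num.Theory.
Import numFieldNormedType.Exports.
Local Open Scope ring_scope.

(** Put [x = (a - b) / (a + b)], so that [0 < x < 1], and let [I] be the integral
over [0, x] in the denominator of the given function, whose value is then
[x / I] times the arithmetic mean of [a] and [b].  As [a] and [b] are [1 + x]
and [1 - x] times this arithmetic mean, the claim is that [I / x], the average
of the integrand over [0, x], lies between [(1 + x)^-1] and [(1 - x)^-1].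

This already holds for the integrand pointwise.  All four integrands have the
form [u t `^ (- q)] with [u t] equal to [1 - t `^ p] or [1 + t `^ p], and [q]
equal to [p^-1] or [1].  For [0 <= t <= x] we have [t `^ p <= t <= x], so
[1 - x <= u t <= 1 + x]; and raising to the power [- q] with [0 <= q <= 1]
brings [u t] at least as close to [1] as inverting it does.  The lemma
[mean_of_powR_integral] carries this out for a general [u] ([powR_oppr_bounds]
is the pointwise estimate), and the four functions are instances. *)

(** The value [y `^ (- q)] lies between [1] and [y^-1]: the power [y `^ q] is
between [1] and [y] on either side of [1]. *)
Lemma powR_oppr_bounds (R : realType) (x y q : R) :
  x < 1 -> 0 <= q <= 1 -> `|y - 1| <= x ->
  (1 + x)^-1 <= y `^ (- q) <= (1 - x)^-1.
Proof.
move=> x1 /andP[q0 q1]; rewrite ler_distl => /andP[ylo yhi].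
have y0 : 0 < y by lra.
have yq0 : 0 < y `^ q by rewrite powR_gt0.
suff /andP[lo hi] : 1 - x <= y `^ q <= 1 + x.
  by rewrite powRN !lef_pV2 ?posrE ?lo ?hi //; lra.
have [y1|/ltW y1] := leP 1 y.
- have := ler1_powR y1 q1; have := ler_powR y1 q0; rewrite powRr0 => *.
  by apply/andP; split; lra.
- have y01 : 0 < y <= 1 by rewrite y0 y1.
  have := ger1_powR y01 q1; have := ger_powR y01 q0; rewrite powRr0 => *.
  by apply/andP; split; lra.
Qed.

Lemma Rintegral_itv_bounds (R : realType) (f : R -> R) (x m M : R) :
  0 < x -> measurable_fun setT f ->
  (forall t, 0 <= t <= x -> m <= f t <= M) ->
  m * x <= \int[@lebesgue_measure R]_(t in `[0, x]) f t <= M * x.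
Proof.
move=> x0 mf fb; set D : set R := `[0, x]%classic.
have mD : measurable D by exact: measurable_itv.
have muD : @lebesgue_measure R D = x%:E by rewrite /D lebesgue_measure_itv /= lte_fin x0 sube0.
have Dx t : D t -> m <= f t <= M by rewrite /D /= in_itv /=; exact: fb.
have cstE c : \int[@lebesgue_measure R]_(t in D) c = c * x.
  by rewrite Rintegral_cst // [X in fine X]muD.
have ic c : (@lebesgue_measure R).-integrable D (EFin \o cst c).
  by apply: measurable_bounded_integrable => //;
    [rewrite [X in (X < _)%E]muD ltry | exact: bounded_cst].
have fi : (@lebesgue_measure R).-integrable D (EFin \o f).
  apply: measurable_bounded_integrable => //.
  - by rewrite [X in (X < _)%E]muD ltry.
  - exact: measurable_funTS.
  exists (`|m| + `|M|); split; first by rewrite num_real.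
  move=> y hy t /Dx /andP[h1 h2]; apply: (le_trans _ (ltW hy)).
  rewrite ler_norml; have := ler_norm M; have := ler_norm (- m).
  rewrite normrN; have := normr_ge0 m; have := normr_ge0 M => *.
  by apply/andP; split; lra.
rewrite -2!cstE; apply/andP; split; apply: le_Rintegral => //.
- exact: ic.
- by move=> t /Dx /andP[].
- exact: ic.
- by move=> t /Dx /andP[].
Qed.

Lemma mean_of_powR_integral (R : realType) (u : R -> R) (q : R) :
  measurable_fun setT u -> 0 <= q <= 1 ->
  (forall t, 0 <= t <= 1 -> `|u t - 1| <= t) ->
  is_mean_on (fun a b : R => b < a)
    (fun a b => (a - b) / (2 * \int[@lebesgue_measure R]_(t in `[0%R,
       ((a - b) / (a + b))%R]) (u t `^ (- q)))).
Proof.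
move=> mu q01 hu a b a0 b0 ba; rewrite (min_r (ltW ba)) (max_l (ltW ba)).
set x := (a - b) / (a + b).
have s0 : 0 < a + b by lra.
have x0 : 0 < x by rewrite divr_gt0 // subr_gt0.
have x1 : x < 1 by rewrite ltr_pdivrMr //; lra.
have xE : x * (a + b) = a - b by rewrite divfK ?gt_eqF.
clearbody x.
have mf : measurable_fun setT (fun t => u t `^ (- q)).
  by apply: (measurableT_comp (measurable_realfun.measurable_powR _) mu).
have fb t : 0 <= t <= x -> (1 + x)^-1 <= u t `^ (- q) <= (1 - x)^-1.
  move=> /andP[t0 tx]; apply: powR_oppr_bounds => //.
  by apply: (le_trans _ tx); apply: hu; rewrite t0 /=; lra.
have /andP[] := Rintegral_itv_bounds _ _ _ _ _ x0 mf fb.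
set I := Rintegral _ _ _.
rewrite ![_^-1 * x]mulrC => Ilo Ihi.
rewrite ler_pdivrMr in Ilo; last lra.
rewrite ler_pdivlMr in Ihi; last lra.
have I0 : 0 < I by rewrite -(pmulr_lgt0 _ (_ : 0 < 1 + x)); lra.
rewrite ler_pdivlMr ?ler_pdivrMr; [|lra|lra].
(* Both [2 * a = (1 + x) * (a + b)] and [2 * b = (1 - x) * (a + b)]. *)
have := ler_wpM2r (ltW s0) Ilo; have := ler_wpM2r (ltW s0) Ihi => h1 h2.
by apply/andP; split; nra.
Qed.

Lemma powR_le_id (R : realType) (p t : R) :
  1 <= p -> 0 <= t <= 1 -> 0 <= t `^ p <= t.
Proof.
move=> p1 /andP[t0 t1]; rewrite powR_ge0 /=.
have [->|tn] := eqVneq t 0; first by rewrite powR0 // gt_eqF //; lra.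
have tp : 0 < t <= 1 by rewrite lt_neqAle eq_sym tn t0.
by have := ger_powR tp p1; rewrite powRr1.
Qed.

(** Writing the inverse as the power [-1] is what makes [mean_of_powR_integral]
cover the integrands without an exponent [- p^-1]; it needs [u >= 0] on the
range of integration, which closeness to [1] provides. *)
Lemma mean_of_inv_integral (R : realType) (u : R -> R) :
  measurable_fun setT u ->
  (forall t, 0 <= t <= 1 -> `|u t - 1| <= t) ->
  is_mean_on (fun a b : R => b < a)
    (fun a b => (a - b) / (2 * \int[@lebesgue_measure R]_(t in `[0%R,
       ((a - b) / (a + b))%R]) (u t)^-1)).
Proof.
move=> mu hu a b a0 b0 ba.
rewrite (@eq_Rintegral _ _ _ _ _
  (fun t : measurableTypeR R => u t `^ (- 1))); last first.
  move=> t; rewrite inE /= in_itv /= => /andP[t0 tx].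
  have t1 : t <= 1 by apply: (le_trans tx); rewrite ler_pdivrMr; lra.
  have := hu t; rewrite t0 t1 ler_distl => /(_ isT) /andP[ulo _].
  by rewrite powR_inv1 //; lra.
by apply: mean_of_powR_integral => //; rewrite ler01 lexx.
Qed.

Theorem theorem2p2 (R : realType) (p : R) (hp : 2 <= p) :
  [/\ is_mean_on (fun a b : R => b < a) (tildeP p),
      is_mean_on (fun a b : R => b < a) (tildeT p),
      is_mean_on (fun a b : R => b < a) (tildeL p) &
      is_mean_on (fun a b : R => b < a) (tildeM p)].
Proof.
have p1 : 1 <= p by lra.
have q01 : 0 <= p^-1 <= 1 by rewrite invr_ge0 invf_le1; [apply/andP; split|]; lra.
have mD : measurable_fun setT (fun t : R => 1 + t `^ p).
  by apply: measurable_realfun.measurable_funD => //; exact: measurable_realfun.measurable_powR.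
have mB : measurable_fun setT (fun t : R => 1 - t `^ p).
  by apply: measurable_realfun.measurable_funB => //; exact: measurable_realfun.measurable_powR.
have hD (t : R) : 0 <= t <= 1 -> `|1 + t `^ p - 1| <= t.
  by move=> /(powR_le_id _ _ _ p1)/andP[? ?]; rewrite addrAC subrr add0r ger0_norm.
have hB (t : R) : 0 <= t <= 1 -> `|1 - t `^ p - 1| <= t.
  move=> /(powR_le_id _ _ _ p1)/andP[? ?].
  by rewrite addrAC subrr add0r normrN ger0_norm.
split.
- exact: (mean_of_powR_integral _ _ _ mB q01 hB).
- exact: (mean_of_inv_integral _ _ mD hD).
- exact: (mean_of_inv_integral _ _ mB hB).
- exact: (mean_of_powR_integral _ _ _ mD q01 hD).
Qed.
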